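(* Let $m,n\in\mathbb{N}$ with $m\le n$. For all $\mu\in \mathrm{M}(\mathbb{R}^m)$ and $\nu\in \mathrm{M}(\mathbb{R}^n)$, $$\inf_{\alpha\in\Phi^+(\mu,n)} d_{\mathrm{TV}}(\alpha,\nu)=\inf_{\beta\in\Phi^-(\nu,m)} d_{\mathrm{TV}}(\mu,\beta).$$
   Context: $\mathrm{M}(\mathbb{R}^n)$ is the set of Borel probability measures on $\mathbb{R}^n$. For $m\le n$, $\mathrm{O}(m,n)=\{V\in\mathbb{R}^{m\times n}: VV^{T}=I_m\}$. For $V\in \mathrm{O}(m,n)$, $b\in\mathbb{R}^m$, $\varphi_{V,b}:\mathbb{R}^n\to\mathbb{R}^m$ is $\varphi_{V,b}(x)=Vx+b$, and $\varphi_{V,b}(\mu)=\mu\circ\varphi_{V,b}^{-1}$ is the pushforward measure. For $\mu\in \mathrm{M}(\mathbb{R}^m)$ and $\nu\in \mathrm{M}(\mathbb{R}^n)$, $$\Phi^-(\nu,m)=\{\beta\in \mathrm{M}(\mathbb{R}^m): \varphi_{V,b}(\nu)=\beta \text{ for some } V\in \mathrm{O}(m,n),\ b\in\mathbb{R}^m\},$$ $$\Phi^+(\mu,n)=\{\alpha\in \mathrm{M}(\mathbb{R}^n): \varphi_{V,b}(\alpha)=\mu \text{ for some } V\in \mathrm{O}(m,n),\ b\in\mathbb{R}^m\}.$$ The total variation metric between $\mu,\nu\in \mathrm{M}(\mathbb{R}^n)$ is $d_{\mathrm{TV}}(\mu,\nu)=\sup_{A}|\mu(A)-\nu(A)|$,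 the supremum being over Borel sets $A\subseteq\mathbb{R}^n$. *)

(* Defs.v *)
From HB Require Import structures.
From mathcomp Require Import all_boot all_order all_algebra.
From mathcomp Require Import all_classical all_reals all_analysis.

Set Implicit Arguments.
Unset Strict Implicit.
Unset Printing Implicit Defensive.

Import Order.TTheory GRing.Theory Num.Theory.
Import numFieldNormedType.Exports.

Local Open Scope classical_set_scope.
Local Open Scope ring_scope.

(* R^n as column vectors, with the Borel sigma-algebra, i.e. the one generated
   by the open sets of the topology that the library puts on ['cV[R]_n]. *)
Definition euclidean (R : realType) (n : nat) : measurableType _ :=
  g_sigma_algebraType (@open 'cV[R]_n).

Definition semi_orthogonal (R : realType) (m n : nat) : set 'M[R]_(m, n) :=
  [set V | V *m V^T = 1%:M].

Definition affine_map (R : realType) (m n : nat) (V : 'M[R]_(m, n))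
    (b : 'cV[R]_m) (x : euclidean R n) : euclidean R m :=
  V *m x + b.

(* Library measures are functions on all sets, unconstrained outside the
   sigma-algebra, so the image of [alpha] under [f] is compared with [beta]
   on measurable sets only. *)
Definition has_pushforward (R : realType) (m n : nat)
    (alpha : probability (euclidean R n) R)
    (f : euclidean R n -> euclidean R m)
    (beta : probability (euclidean R m) R) : Prop :=
  forall A : set (euclidean R m), measurable A -> pushforward alpha f A = beta A.

Definition Phi_minus (R : realType) (n : nat)
    (nu : probability (euclidean R n) R) (m : nat) :
    set (probability (euclidean R m) R) :=
  [set beta | exists (V : 'M[R]_(m, n)) (b : 'cV[R]_m),
    semi_orthogonal V /\ has_pushforward nu (affine_map V b) beta].
Arguments Phi_minus {R n} nu m.

Definition Phi_plus (R : realType) (m : nat)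
    (mu : probability (euclidean R m) R) (n : nat) :
    set (probability (euclidean R n) R) :=
  [set alpha | exists (V : 'M[R]_(m, n)) (b : 'cV[R]_m),
    semi_orthogonal V /\ has_pushforward alpha (affine_map V b) mu].
Arguments Phi_plus {R m} mu n.

Definition dTV (R : realType) (n : nat)
    (mu nu : probability (euclidean R n) R) : \bar R :=
  ereal_sup [set `|mu A - nu A|%E | A in @measurable _ (euclidean R n)].

(* Main.v *)
Require Import Defs.
From HB Require Import structures.
From mathcomp Require Import all_boot all_order all_algebra.
From mathcomp Require Import all_classical all_reals all_analysis.
From mathcomp Require Import measurable_realfun lra.

(** If [phi] pushes alpha forward to mu, mu - phi(nu) is alpha - nu evaluated
    on sets of the form [phi^-1 B], so passing to the image cannot increase the
    distance.  Conversely let beta be the image of nu under [phi = phi_(V,b)].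
    The map [s y = V^T (y - b)] is a section of [phi]. Take a Hahn decomposition
    (P, N) of mu - beta and let f <= 1 be the density with respect to beta of
    sigma = beta|P + mu|N <= beta.  Then
      alpha(A) = int_A f(phi x) nu(dx) + (mu - beta)|P (s^-1 A)
    is a lift of mu, and alpha(A) - nu(A) <= mu(P) - beta(P) for every A. *)

Set Implicit Arguments.
Unset Strict Implicit.
Unset Printing Implicit Defensive.

Import Order.TTheory GRing.Theory Num.Theory.
Import numFieldNormedType.Exports.

Local Open Scope classical_set_scope.
Local Open Scope ring_scope.

(** Neighbourhoods in ['cV[R]_m] are generated entrywise, so it suffices to treat the finitely many
    coordinates, each a finite sum of scaled coordinate functions plus a constant. *)
Lemma mulmx_addr_continuous (R : realType) (m n : nat) (V : 'M[R]_(m, n))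
    (b : 'cV[R]_m) : continuous (fun x : 'cV[R]_n => V *m x + b).
Proof.
move=> x A [B Bx BA].
have continuous_coord i :
    continuous (fun z : 'cV[R]_n => (V *m z + b)%R i ord0).
  rewrite (_ : (fun z : 'cV[R]_n => _) =
      (fun z => (\sum_j V i j * z j ord0)%R + b i ord0)%R); last first.
    by apply/funext => z; rewrite !mxE.
  move=> z; apply: (@continuousD _ _ _
      (fun z : 'cV[R]_n => (\sum_j V i j * z j ord0)%R) (fun=> b i ord0)).
    apply: (@continuous_big _ _ _ _ xpredT); first exact: add_continuous.
    move=> j _ {}z; apply: (@continuousM _ _ (fun=> V i j)).
      exact: cst_continuous.
    exact: coord_continuous.
  exact: cst_continuous.
have FF : Filter (nbhs x) by exact: (nbhs_filter (x : 'cV[R]_n)).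
have Bnear : \forall z \near x, forall i, B i ord0 ((V *m z + b)%R i ord0).
  apply: (@filter_forall _ _ _ (nbhs x) FF) => i.
  exact: continuous_coord (Bx i ord0).
apply: (@filterS _ _ FF _ _ _ Bnear) => z Bz.
by apply: BA => i j; rewrite (ord1 j).
Qed.

Lemma measurable_affine_map (R : realType) (m n : nat) (V : 'M[R]_(m, n))
    (b : 'cV[R]_m) : measurable_fun setT (affine_map V b).
Proof.
apply: (@measurability _ _ (euclidean R n) (euclidean R m) setT _
  (@open 'cV[R]_m)) => //.
move=> _ [A oA <-]; rewrite setTI; apply: sub_sigma_algebra.
apply: open_comp => //= x _; exact: mulmx_addr_continuous.
Qed.

(** Writing [V^T (y - b)] as an instance of [affine_map] makes its measurability a case of
    [measurable_affine_map]. *)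
Definition affine_section (R : realType) (m n : nat) (V : 'M[R]_(m, n))
    (b : 'cV[R]_m) : euclidean R m -> euclidean R n :=
  affine_map V^T (- (V^T *m b)).

Lemma affine_sectionK (R : realType) (m n : nat) (V : 'M[R]_(m, n))
    (b : 'cV[R]_m) : semi_orthogonal V ->
  cancel (affine_section V b) (affine_map V b).
Proof.
move=> VV y; rewrite /affine_section /affine_map -mulmxBr mulmxA VV mul1mx.
exact: subrK.
Qed.

Section strengthened_measure.
Context d (T : measurableType d) (R : realType).
Variable mu : {measure set T -> \bar R}.
Local Open Scope ereal_scope.

(** This alias, like [probability_of_measure] below, carries a proof as an argument, so that the
    richer structure can be attached to a measure already built. *)
Definition finite_of_measure of fin_num_fun mu : set T -> \bar R := mu.

Section finite.
Hypothesis mu_fin : fin_num_fun mu.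
HB.instance Definition _ := Measure.copy (finite_of_measure mu_fin) mu.
HB.instance Definition _ := Measure_isFinite.Build _ _ _
  (finite_of_measure mu_fin) mu_fin.
End finite.

Definition probability_of_measure of mu setT = 1 : set T -> \bar R := mu.

Section probability.
Hypothesis mu1 : mu setT = 1.
HB.instance Definition _ := Measure.copy (probability_of_measure mu1) mu.
HB.instance Definition _ := Measure_isProbability.Build _ _ _
  (probability_of_measure mu1) mu1.
End probability.

End strengthened_measure.

Section bounded_density.
Context d (T : measurableType d) (R : realType).
Local Open Scope ereal_scope.

(** Domination gives absolute continuity, hence a Radon-Nikodym density. That density need only be
    at most 1 almost everywhere; truncation gives the bound at every point. *)
Lemma bounded_density (mu nu : {finite_measure set T -> \bar R}) :
  (forall A, measurable A -> nu A <= mu A) ->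
  exists f : T -> \bar R, [/\ measurable_fun setT f, forall x, 0 <= f x <= 1 &
    forall A, measurable A -> nu A = \int[mu]_(x in A) f x].
Proof.
move=> numu.
have : nu `<< mu.
  apply/null_content_dominatesP => A mA muA.
  by apply/eqP; rewrite eq_le measure_ge0 andbT -muA numu.
move=> /radon_nikodym_finite[f [f0 intf fE]].
have mf := measurable_int _ intf.
have mg : measurable_fun setT (fun x => mine (f x) 1).
  by apply: measurable_mine => //; exact: measurable_cst.
have g0 x : 0 <= mine (f x) 1 by rewrite le_min f0 lee01.
exists (fun x => mine (f x) 1); split => //.
  by move=> x; rewrite g0 ge_min lexx orbT.
move=> A mA.
(* Truncating the density f at 1 changes no integral: on D = {f > 1} one has
   int_(A & D) f = nu (A & D) <= mu (A & D). *)
have mD : measurable (setT `&` [set x | 1 < f x]).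
  exact: emeasurable_fun_o_infty.
rewrite setTI in mD.
set D := [set x | 1 < f x] in mD.
have split_int h : measurable_fun setT h -> (forall x, 0 <= h x) ->
    \int[mu]_(x in A) h x =
    \int[mu]_(x in A `&` D) h x + \int[mu]_(x in A `&` ~` D) h x.
  move=> mh h0; rewrite -ge0_integral_setU//=.
  - by rewrite -setIUr setUv setIT.
  - exact: measurableI.
  - by apply: measurableI => //; exact: measurableC.
  - exact: measurable_funTS.
  - by apply/disj_setPS => x [[_ ?] [_ ?]].
apply/eqP; rewrite eq_le; apply/andP; split; last first.
  rewrite fE//; apply: ge0_le_integral => //.
  - exact: measurable_funTS.
  - exact: measurable_funTS.
  - by move=> x _; rewrite ge_min lexx.
rewrite fE// split_int// [leRHS]split_int//.
apply: leeD; last first.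
  apply: ge0_le_integral => //.
  - by apply: measurableI => //; exact: measurableC.
  - exact: measurable_funTS.
  - exact: measurable_funTS.
  - by move=> x [_ /negP]; rewrite -leNgt le_min lexx.
have mAD : measurable (A `&` D) by exact: measurableI.
rewrite -fE//; apply: (le_trans (numu _ mAD)).
rewrite (eq_integral (cst 1)) ?integral_cst ?mul1e//.
by move=> x; rewrite inE => -[_ /ltW /min_idPr].
Qed.

End bounded_density.

Section density_measure.
Context d (T : measurableType d) (R : realType).
Local Open Scope ereal_scope.
Variables (mu : {measure set T -> \bar R}) (f : T -> \bar R).
Hypotheses (mf : measurable_fun setT f) (f0 : forall x, 0 <= f x).

Definition density_measure of measurable_fun setT f & (forall x, 0 <= f x) :=
  fun A => \int[mu]_(x in A) f x.

Let dm0 : density_measure mf f0 set0 = 0.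
Proof. exact: integral_set0. Qed.

Let dm_ge0 A : 0 <= density_measure mf f0 A.
Proof. exact: integral_ge0. Qed.

Let dm_sigma_additive : semi_sigma_additive (density_measure mf f0).
Proof. exact: semi_sigma_additive_nng_induced. Qed.

HB.instance Definition _ := isMeasure.Build _ _ _ (density_measure mf f0)
  dm0 dm_ge0 dm_sigma_additive.

End density_measure.

Section tv_lift.
Context d d' (X : measurableType d) (Y : measurableType d') (R : realType).
Variables (phi : X -> Y) (s : Y -> X).
Hypotheses (mphi : measurable_fun setT phi) (ms : measurable_fun setT s).
Hypothesis sK : cancel s phi.
Local Open Scope ereal_scope.

(** Only a measurable map with a measurable section matters here, not affinity. A single set [P]
    serves all [A], so the bound is one of the terms controlled by the total variation of [mu] and
    [beta]. *)
Lemma tv_lift (nu : probability X R) (beta mu : probability Y R) :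
  (forall B, measurable B -> nu (phi @^-1` B) = beta B) ->
  exists alpha : probability X R,
    (forall B, measurable B -> alpha (phi @^-1` B) = mu B) /\
    exists2 P, measurable P &
      forall A, measurable A -> `|alpha A - nu A| <= mu P - beta P.
Proof.
move=> nuphi.
pose delta : {charge set Y -> \bar R} := cadd (charge_of_finite_measure mu)
  (copp (charge_of_finite_measure beta)).
have deltaE A : delta A = mu A - beta A by [].
have [P [N PN]] := Hahn_decomposition delta.
have [[mP _] [mN N0] PUN PIN] := PN.
pose pi : {measure set Y -> \bar R} := jordan_pos PN.
have piE A : measurable A -> pi A = mu (A `&` P) - beta (A `&` P).
  by move=> mA; rewrite [LHS]jordan_posE cjordan_posE /crestr0 mem_set.
have splitPN (m : {measure set Y -> \bar R}) A : measurable A ->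
    m A = m (A `&` P) + m (A `&` N).
  move=> mA; rewrite -measureU; [|exact: measurableI|exact: measurableI|].
    by rewrite -setIUr PUN setIT.
  by rewrite setIACA PIN setI0.
have [sigma sigmaE] : exists sigma : {measure set Y -> \bar R},
    forall A, sigma A = beta (A `&` P) + mu (A `&` N).
  exists (measure_add (mrestr beta mP) (mrestr mu mN)) => A.
  exact: measure_addE.
(* On subsets of the negative set [N], [mu] is at most [beta]. *)
have sigma_le A : measurable A -> sigma A <= beta A.
  move=> mA; rewrite sigmaE (splitPN beta A mA); apply: leeD2l.
  have mAN : measurable (A `&` N) by exact: measurableI.
  by have := N0 _ mAN (@subIsetr _ _ _); rewrite deltaE sube_le0.
have sigma_fin : fin_num_fun sigma.
  move=> A mA; rewrite ge0_fin_numE ?measure_ge0//.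
  apply: (le_lt_trans (sigma_le _ mA)).
  by rewrite ltey_eq fin_num_measure.
pose sigmaF : {finite_measure set Y -> \bar R} := finite_of_measure sigma_fin.
have [f [mf f01 fE]] := @bounded_density _ _ _ beta sigmaF sigma_le.
have {}fE B : measurable B -> sigma B = \int[beta]_(y in B) f y by exact: fE.
have mfphi : measurable_fun setT (f \o phi) by exact: measurableT_comp.
have fphi0 x : 0 <= (f \o phi) x by have /andP[] := f01 (phi x).
have [lift liftE] : exists lift : {measure set X -> \bar R},
    forall A, lift A = pi (s @^-1` A).
  by unshelve eexists (pushforward pi s).
have [alpha alphaE] : exists alpha : {measure set X -> \bar R},
    forall A, alpha A = \int[nu]_(x in A) f (phi x) + pi (s @^-1` A).
  exists (measure_add (density_measure nu mfphi fphi0) lift) => A.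
  by rewrite -liftE; exact: measure_addE.
have alpha_mu B : measurable B -> alpha (phi @^-1` B) = mu B.
  move=> mB; rewrite alphaE.
  have -> : s @^-1` (phi @^-1` B) = B by apply/seteqP; split=> y /=; rewrite sK.
  (* Change of variables along [phi]: the image of [nu] is [beta], and [f] is the density of [sigma]
     with respect to [beta]. *)
  have -> : \int[nu]_(x in phi @^-1` B) f (phi x) = sigma B.
    rewrite -(ge0_integral_pushforward mphi) //.
    - by rewrite (fE _ mB); apply: eq_measure_integral => C mC _; exact: nuphi.
    - exact: measurable_funTS.
    - by move=> y _; have /andP[] := f01 y.
  (* In [sigma B + pi B] the two occurrences of [beta (B & P)] cancel, being finite, and the parts
     of [mu] on [P] and [N] add up to [mu B]. *)
  rewrite sigmaE piE// (splitPN mu B mB) addeC -addeA.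
  by rewrite [- _ + _]addeA [- _ + _]addeC subee ?add0e// fin_num_measure//;
    exact: measurableI.
have alpha1 : alpha setT = 1.
  by rewrite -(preimage_setT phi) alpha_mu// probability_setT.
pose alphaP : probability X R := probability_of_measure alpha1.
exists alphaP; split=> //; exists P => // A mA.
(* Since [f <= 1], the integral part of [alpha C] is at most [nu C]; the other part is at most the
   total mass of [pi], which is [mu P - beta P]. *)
have upper C : measurable C -> alphaP C - nu C <= mu P - beta P.
  move=> mC; rewrite leeBlDl ?fin_num_measure// [alphaP C]alphaE leeD//.
    rewrite -[leRHS]mul1e -integral_cst//; apply: ge0_le_integral => //.
    - by move=> x _; exact: fphi0.
    - exact: measurable_funTS.
    - by move=> x _; have /andP[] := f01 (phi x).
  have msC : measurable (s @^-1` C).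
    by rewrite -[X in measurable X]setTI; exact: ms.
  rewrite (le_trans (le_measure pi _ _ (@subsetT _ _)))//= ?inE//.
  by rewrite piE// setTI.
(* The lower bound is the upper bound on the complement. *)
have [ge0|/ltW le0] := leP 0 (alphaP A - nu A).
  by rewrite gee0_abs// upper.
rewrite lee0_abs//; apply: le_trans (upper _ (measurableC mA)).
rewrite !probability_setC//.
have : alphaP A \is a fin_num by rewrite fin_num_measure.
have : nu A \is a fin_num by rewrite fin_num_measure.
case: (alphaP A) => [a| |]//; case: (nu A) => [b| |]// _ _.
by rewrite -!EFinB -EFinN lee_fin; lra.
Qed.

End tv_lift.

Lemma dTV_ub (R : realType) (n : nat) (mu nu : probability (euclidean R n) R)
    (A : set (euclidean R n)) :
  measurable A -> (`|mu A - nu A| <= dTV mu nu)%E.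
Proof. by move=> mA; apply: ereal_sup_ubound; exists A. Qed.

Lemma probability_pushforward d d' (X : measurableType d)
    (Y : measurableType d') (R : realType) (nu : probability X R) (f : X -> Y) :
  measurable_fun setT f ->
  exists beta : probability Y R, forall B, beta B = nu (f @^-1` B).
Proof.
move=> mf.
pose F : {mfun X >-> Y} := HB.pack f (isMeasurableFun.Build _ _ _ _ f mf).
by exists (distribution nu F).
Qed.

Theorem theoremV2 (R : realType) (m n : nat) (hmn : (m <= n)%N)
    (mu : probability (euclidean R m) R) (nu : probability (euclidean R n) R) :
  ereal_inf [set dTV alpha nu | alpha in Phi_plus mu n] =
  ereal_inf [set dTV mu beta | beta in Phi_minus nu m].
Proof.
apply/eqP; rewrite eq_le; apply/andP; split; apply: le_ereal_inf_tmp.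
(* Every [beta] has a lift [alpha], through the same [V] and [b], at least as close to [nu] as
   [beta] is to [mu]. *)
- move=> _ [beta [V [b [VV nubeta]]] <-].
  have mphi := measurable_affine_map V b.
  have ms : measurable_fun setT (affine_section V b).
    exact: measurable_affine_map.
  have [alpha [alphamu [P mP alphaP]]] :=
    tv_lift mphi ms (affine_sectionK b VV) mu nubeta.
  apply: (@le_trans _ _ (dTV alpha nu)).
    by apply: ereal_inf_lbound; exists alpha => //; exists V, b.
  apply: ge_ereal_sup => _ [A mA <-].
  apply: le_trans (alphaP A mA) _.
  exact: le_trans (lee_abs _) (dTV_ub mu beta mP).
(* Conversely, [beta] is the image of [nu] under the map sending [alpha] to [mu]; preimages of
   measurable sets are among the sets tested in [dTV alpha nu]. *)
- move=> _ [alpha [V [b [VV alphamu]]] <-].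
  have mphi := measurable_affine_map V b.
  have [beta betaE] := probability_pushforward nu mphi.
  apply: (@le_trans _ _ (dTV mu beta)).
    by apply: ereal_inf_lbound; exists beta => //; exists V, b; split.
  apply: ge_ereal_sup => _ [B mB <-].
  rewrite betaE -alphamu//; apply: dTV_ub.
  by rewrite -[X in measurable X]setTI; exact: mphi.
Qed.
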